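(* Let $X$ and $Y$ be real Banach spaces and let $N$ be an absolute normalized norm on $\mathbb{R}^2$ such that $(1,0)$ is an extreme point of the closed unit ball $B_{(\mathbb{R}^2,N^\ast)}$ of $(\mathbb{R}^2,N^\ast)$. If $X\oplus_N Y$ is $\delta$-average rough for some $\delta>0$, then $X$ is $\delta$-average rough.
   Context: For a Banach space $X$, $S_X$ denotes its unit sphere. For $\delta>0$, a Banach space $X$ is $\delta$-average rough if, whenever $n\in\mathbb{N}$ ($n\ge 1$) and $x_1,\dots,x_n\in S_X$, $$\limsup_{\|y\|\to 0}\frac1n\sum_{i=1}^n\frac{\|x_i+y\|+\|x_i-y\|-2}{\|y\|}\geq\delta,$$ where $y$ ranges over nonzero elements of $X$. A norm $N$ on $\mathbb{R}^2$ is absolute if $N(a,b)=N(|a|,|b|)$ for all $(a,b)\in\mathbb{R}^2$, and normalized if $N(1,0)=N(0,1)=1$. The dual norm is $N^\ast(c,d)=\max_{N(a,b)\leq 1}(|ac|+|bd|)$; it is again absolute and normalized. $X\oplus_N Y$ is the product space $X\times Y$ with the norm $\|(x,y)\|_N=N(\|x\|,\|y\|)$. *)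

(* Defs.v *)
From HB Require Import structures.
From mathcomp Require Import all_boot all_order all_algebra.
From mathcomp Require Import ring lra.
From mathcomp Require Import all_classical all_reals all_analysis.

Set Implicit Arguments.
Unset Strict Implicit.
Unset Printing Implicit Defensive.

Import Order.TTheory GRing.Theory Num.Theory.
Import numFieldNormedType.Exports.

Local Open Scope classical_set_scope.
Local Open Scope ring_scope.

Definition extreme_point (R : realType) (E : lmodType R) (A : set E) (x : E) :=
  A x /\ forall (y z : E) (t : R), A y -> A z -> 0 < t < 1 ->
    x = t *: y + (1 - t) *: z -> y = x /\ z = x.

Record abs_norm (R : realType) := AbsNorm {
  abs_norm_fun :> R * R -> R ;
  abs_normD : forall v w : R * R,
    abs_norm_fun (v + w) <= abs_norm_fun v + abs_norm_fun w ;
  abs_normZ : forall (t : R) (v : R * R),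
    abs_norm_fun (t *: v) = `|t| * abs_norm_fun v ;
  abs_norm_eq0 : forall v : R * R, abs_norm_fun v = 0 -> v = 0 ;
  abs_norm_abs : forall a b : R,
    abs_norm_fun (a, b) = abs_norm_fun (`|a|, `|b|) ;
  abs_norm10 : abs_norm_fun (1, 0) = 1 ;
  abs_norm01 : abs_norm_fun (0, 1) = 1
}.

Definition closed_unit_ball (R : realType) (N : R * R -> R) : set (R * R) :=
  [set v | N v <= 1].

(* The unit ball of N is compact, so this supremum is a maximum. *)
Definition dual_norm (R : realType) (N : abs_norm R) (w : R * R) : R :=
  sup [set `|v.1 * w.1| + `|v.2 * w.2| | v in closed_unit_ball N].

Section abs_norm_lemmas.
Context (R : realType) (N : abs_norm R).

Lemma abs_norm_le_l (a a' b : R) : 0 <= a <= a' -> N (a, b) <= N (a', b).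
Proof.
move=> /andP[a0 aa'].
have [a'0|a'0] := eqVneq a' 0; first by have -> : a = a' by lra.
have a'_gt0 : 0 < a' by rewrite lt_neqAle eq_sym a'0 (le_trans a0 aa').
pose l := (1 + a / a') / 2.
have r0 : 0 <= a / a' by rewrite divr_ge0// ltW.
have r1 : a / a' <= 1 by rewrite ler_pdivrMr// mul1r.
have -> : (a, b) = l *: (a', b) + (1 - l) *: (- a', b).
  by apply/pair_equal_spec; split; rewrite /GRing.scale/= /GRing.scale/= /l; field.
apply: le_trans (abs_normD N _ _) _.
rewrite !abs_normZ (abs_norm_abs N (- a')) normrN -abs_norm_abs -mulrDl.
rewrite !ger0_norm ?subr_ge0 /l; [|lra..].
by rewrite addrC subrK mul1r.
Qed.

Lemma abs_norm_le_r (a b b' : R) : 0 <= b <= b' -> N (a, b) <= N (a, b').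
Proof.
move=> /andP[b0 bb'].
have [b'0|b'0] := eqVneq b' 0; first by have -> : b = b' by lra.
have b'_gt0 : 0 < b' by rewrite lt_neqAle eq_sym b'0 (le_trans b0 bb').
pose l := (1 + b / b') / 2.
have r0 : 0 <= b / b' by rewrite divr_ge0// ltW.
have r1 : b / b' <= 1 by rewrite ler_pdivrMr// mul1r.
have -> : (a, b) = l *: (a, b') + (1 - l) *: (a, - b').
  by apply/pair_equal_spec; split; rewrite /GRing.scale/= /GRing.scale/= /l; field.
apply: le_trans (abs_normD N _ _) _.
rewrite !abs_normZ (abs_norm_abs N a (- b')) normrN -abs_norm_abs -mulrDl.
rewrite !ger0_norm ?subr_ge0 /l; [|lra..].
by rewrite addrC subrK mul1r.
Qed.

Lemma abs_norm_l (a : R) : N (a, 0) = `|a|.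
Proof.
have -> : (a, 0) = a *: ((1, 0) : R * R).
  by apply/pair_equal_spec; split; rewrite /GRing.scale/= /GRing.scale/=; ring.
by rewrite abs_normZ abs_norm10 mulr1.
Qed.

Lemma abs_norm_r (b : R) : N (0, b) = `|b|.
Proof.
have -> : (0, b) = b *: ((0, 1) : R * R).
  by apply/pair_equal_spec; split; rewrite /GRing.scale/= /GRing.scale/=; ring.
by rewrite abs_normZ abs_norm01 mulr1.
Qed.

Lemma abs_norm_ge_l (a b : R) : `|a| <= N (a, b).
Proof.
rewrite -[leLHS]normr_id -abs_norm_l [leRHS]abs_norm_abs.
by apply: abs_norm_le_r; rewrite lexx normr_ge0.
Qed.

Lemma abs_norm_ge_r (a b : R) : `|b| <= N (a, b).
Proof.
rewrite -[leLHS]normr_id -abs_norm_r [leRHS]abs_norm_abs.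
by apply: abs_norm_le_l; rewrite lexx normr_ge0.
Qed.

Lemma abs_norm_le_add (a b : R) : N (a, b) <= `|a| + `|b|.
Proof.
rewrite -abs_norm_l -abs_norm_r.
have -> : (a, b) = ((a, 0) : R * R) + (0, b).
  by apply/pair_equal_spec; rewrite /= addr0 add0r.
exact: abs_normD.
Qed.

Lemma dual_norm_has_sup (w : R * R) :
  has_sup [set `|v.1 * w.1| + `|v.2 * w.2| | v in closed_unit_ball N].
Proof.
split.
  exists 0, (0, 0); last by rewrite /= !mul0r normr0 addr0.
  by rewrite /closed_unit_ball/= abs_norm_l normr0.
exists (`|w.1| + `|w.2|) => _ [[a b] /= Nab <-].
rewrite !normrM lerD// ler_piMl//.
  exact: le_trans (abs_norm_ge_l a b) Nab.
exact: le_trans (abs_norm_ge_r a b) Nab.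
Qed.

End abs_norm_lemmas.

Definition abs_sum (R : realType) (N : abs_norm R) (X Y : normedModType R) :
  Type := (X * Y)%type.

Section abs_sum_normed.
Context (R : realType) (N : abs_norm R) (X Y : normedModType R).

HB.instance Definition _ := GRing.Lmodule.copy (abs_sum N X Y) (X * Y)%type.

Definition abs_sum_norm (p : abs_sum N X Y) : R := N (`|p.1|, `|p.2|).

Lemma abs_sum_normD p q :
  abs_sum_norm (p + q) <= abs_sum_norm p + abs_sum_norm q.
Proof.
apply: (@le_trans _ _ (N (`|p.1| + `|q.1|, `|p.2 + q.2|))).
  by apply: abs_norm_le_l; rewrite normr_ge0 ler_normD.
apply: (@le_trans _ _ (N (`|p.1| + `|q.1|, `|p.2| + `|q.2|))).
  by apply: abs_norm_le_r; rewrite normr_ge0 ler_normD.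
exact: (abs_normD N (`|p.1|, `|p.2|) (`|q.1|, `|q.2|)).
Qed.

Lemma abs_sum_normZ (t : R) p : abs_sum_norm (t *: p) = `|t| * abs_sum_norm p.
Proof.
rewrite /abs_sum_norm /= !normrZ -[in RHS](normr_id t).
by rewrite -(abs_normZ N `|t| (`|p.1|, `|p.2|)).
Qed.

Lemma abs_sum_norm_eq0 p : abs_sum_norm p = 0 -> p = 0.
Proof.
by case: p => x y /abs_norm_eq0 [] /normr0_eq0 -> /normr0_eq0 ->.
Qed.

HB.instance Definition _ := Lmodule_isNormed.Build R (abs_sum N X Y)
  abs_sum_normD abs_sum_normZ abs_sum_norm_eq0.

Lemma abs_sum_normE (p : abs_sum N X Y) : `|p| = N (`|p.1|, `|p.2|).
Proof. by []. Qed.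

End abs_sum_normed.

Section abs_sum_complete.
Context (R : realType) (N : abs_norm R) (X Y : completeNormedModType R).

Lemma abs_sum_complete (F : set_system (abs_sum N X Y)) :
  ProperFilter F -> cauchy F -> cvg F.
Proof.
move=> FF /cauchy_ballP Fc.
have c1 : cvg ((fun p : abs_sum N X Y => p.1) @ F).
  apply: cauchy_cvg; apply/cauchy_ballP => e e0.
  have [[A B] /= [FA FB] AB] := Fc _ e0.
  exists ([set p.1 | p in A], [set p.1 | p in B]) => /=.
    by split; [apply: filterS FA|apply: filterS FB] => p ?; exists p.
  move=> [_ _] /= [[p Ap <-] [q Bq <-]].
  have := AB (p, q) (conj Ap Bq); rewrite -!ball_normE /=.
  by apply: le_lt_trans; rewrite abs_sum_normE -[leLHS]normr_id abs_norm_ge_l.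
have c2 : cvg ((fun p : abs_sum N X Y => p.2) @ F).
  apply: cauchy_cvg; apply/cauchy_ballP => e e0.
  have [[A B] /= [FA FB] AB] := Fc _ e0.
  exists ([set p.2 | p in A], [set p.2 | p in B]) => /=.
    by split; [apply: filterS FA|apply: filterS FB] => p ?; exists p.
  move=> [_ _] /= [[p Ap <-] [q Bq <-]].
  have := AB (p, q) (conj Ap Bq); rewrite -!ball_normE /=.
  by apply: le_lt_trans; rewrite abs_sum_normE -[leLHS]normr_id abs_norm_ge_r.
apply/cvg_ex; exists ((lim ((fun p : abs_sum N X Y => p.1) @ F),
                       lim ((fun p : abs_sum N X Y => p.2) @ F)) : abs_sum N X Y).
apply/cvgrPdist_lt => e e0; have e20 : 0 < e / 2 by rewrite divr_gt0.
move/cvgrPdist_lt : c1 => /(_ _ e20) c1.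
move/cvgrPdist_lt : c2 => /(_ _ e20) c2.
near=> p; rewrite abs_sum_normE.
apply: le_lt_trans (abs_norm_le_add _ _ _) _; rewrite !normr_id [e]splitr ltrD//.
  by near: p.
by near: p.
Unshelve. all: by end_near. Qed.

HB.instance Definition _ :=
  Uniform_isComplete.Build (abs_sum N X Y) abs_sum_complete.

End abs_sum_complete.

Definition average_roughness (R : realType) (X : normedModType R) (n : nat)
    (x : 'I_n -> X) (y : X) : R :=
  n%:R^-1 * \sum_(i < n) (`|x i + y| + `|x i - y| - 2) / `|y|.

(* [0^'] is the filter of punctured neighbourhoods of 0, so the limit superior
   is taken over nonzero [y] with [`|y|] tending to 0. *)
Definition average_rough (R : realType) (X : completeNormedModType R)
    (delta : R) : Prop :=
  forall (n : nat) (x : 'I_n -> X), (1 <= n)%N -> (forall i, `|x i| = 1) ->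
    (delta%:E <=
      limf_esup (fun y : X => (average_roughness x y)%:E) 0%R^')%E.

(* Main.v *)
Require Import Defs.
From HB Require Import structures.
From mathcomp Require Import all_boot all_order all_algebra.
From mathcomp Require Import ring lra.
From mathcomp Require Import all_classical all_reals all_analysis.

(** Extremality of (1, 0) in the dual ball is smoothness of [N] at (1, 0).
    Indeed, convexity makes [(N (1, t) - 1) / t] nondecreasing in [t > 0]; if
    it stayed above some [e > 0], then [N (a, b) >= |a| + e * |b|] everywhere,
    so (1, e) and (1, -e) would lie in the dual ball and have (1, 0) as their
    midpoint. Hence, for every [e > 0], [N (1, t) <= 1 + e * t] for all small
    [t >= 0] ([abs_norm_flat]).

    Given unit vectors [x i] of [X], apply the hypothesis to the unit vectors
    [(x i, 0)] of the sum. For a small increment [(u, v)], flatness gives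
    [|(x i + u, v)| <= |x i + u| + e * |v|], so the second coordinate
    contributes at most [2 * e] to the average roughness of the [(x i, 0)] at
    [(u, v)]; moreover, since [|u| <= |(u, v)|] and [|x i + u| + |x i - u| - 2]
    is nonnegative, the rest is at most the average roughness of the [x i] at
    [u] ([average_roughness_abs_sum_le]). When [3 * e <= delta], a value
    above [delta - e] forces [u != 0], and [u] is then a direction in which
    the average roughness of the [x i] is above [delta - 3 * e]. *)

Import Order.TTheory GRing.Theory Num.Theory.
Import numFieldNormedType.Exports.
Local Open Scope classical_set_scope.
Local Open Scope ring_scope.

Lemma le_limf_esup_dnbhs0P (R : realType) (V : normedModType R) (f : V -> R)
    (d : R) :
  (d%:E <= limf_esup (fun y => (f y)%:E) 0%R^')%E <->
  forall e r : R, 0 < e -> 0 < r ->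
    exists y : V, [/\ y != 0, `|y| < r & d - e < f y].
Proof.
split=> [dle e r e0 r0|H].
  pose W := [set y : V | y != 0 /\ `|y| < r].
  have W0 : (0 : V)^' W.
    near=> y; split; first by near: y; exact: nbhs_dnbhs_neq.
    by near: y; exact: dnbhs0_lt.
  have : ((d - e)%:E < ereal_sup ((fun y => (f y)%:E) @` W))%E.
    apply: (@lt_le_trans _ _ d%:E); first by rewrite lte_fin ltrBlDr ltrDl.
    by apply: le_trans dle _; apply: ereal_inf_lbound; exists W.
  by move=> /ereal_sup_gt[_ [y [y0 yr] <-]]; rewrite lte_fin => fy; exists y.
apply: le_ereal_inf_tmp => _ [A /= A0 <-].
have [r /= r0 rA] := (nbhs_ballP _ _).1 A0.
apply/lee_addgt0Pr => e e0.
have [y [y0 yr fy]] := H e r e0 r0.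
apply: (@le_trans _ _ ((f y)%:E + e%:E)%E).
  by rewrite -EFinD lee_fin -lerBlDr ltW.
apply: leeD2r; apply: ereal_sup_ubound; exists y => //.
by apply: rA => //; rewrite -ball_normE /= sub0r normrN.
Unshelve. all: by end_near. Qed.

Section abs_norm_smooth.
Context (R : realType) (N : abs_norm R).

(** This is the tangent inequality that would make (1, e) a norming
    functional of (1, 0); homogeneity extends it from [a = 1] to all [a], and
    normalization covers the case [a = 0], which needs [e <= 1]. *)
Lemma abs_norm_ge_affine (e : R) : 0 <= e ->
  (forall t, 0 < t -> 1 + e * t <= N (1, t)) ->
  forall a b, `|a| + e * `|b| <= N (a, b).
Proof.
move=> e0 He a b; have e1 : e <= 1.
  have := le_trans (He 1 ltr01) (abs_norm_le_add N 1 1).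
  by rewrite normr1 mulr1; lra.
have [->|b0] := eqVneq b 0; first by rewrite abs_norm_l normr0 mulr0 addr0.
have [->|a0] := eqVneq a 0.
  by rewrite abs_norm_r normr0 add0r ler_piMl.
have a_gt0 : 0 < `|a| by rewrite normr_gt0.
set t := `|b| / `|a|; have bE : `|b| = `|a| * t by rewrite mulrC divfK// gt_eqF.
have -> : N (a, b) = `|a| * N (1, t).
  rewrite abs_norm_abs bE -[in RHS](normr_id a) -abs_normZ; congr (N _).
  by apply/pair_equal_spec; rewrite /GRing.scale/= /GRing.scale/= mulr1.
have t0 : 0 < t by rewrite divr_gt0 ?normr_gt0.
have := ler_wpM2l (ltW a_gt0) (He t t0); rewrite bE; lra.
Qed.

(** Convexity propagates the bound from the endpoints [0] and [t0]. *)
Lemma abs_norm_le_affine (e t0 t : R) : N (1, t0) <= 1 + e * t0 ->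
  0 <= t <= t0 -> N (1, t) <= 1 + e * t.
Proof.
move=> Nt0 /andP[t_ge0 tt0].
have [t00|t00] := eqVneq t0 0.
  by have -> : t = t0 by lra.
have t0_gt0 : 0 < t0 by rewrite lt_neqAle eq_sym t00 (le_trans t_ge0 tt0).
pose l := t / t0.
have l0 : 0 <= l by rewrite divr_ge0// ltW.
have l1 : l <= 1 by rewrite ler_pdivrMr// mul1r.
have tE : t = l * t0 by rewrite divfK.
have -> : (1, t) = (1 - l) *: ((1, 0) : R * R) + l *: (1, t0).
  by apply/pair_equal_spec; split;
    rewrite /GRing.scale/= /GRing.scale/= ?tE; ring.
apply: le_trans (abs_normD N _ _) _.
rewrite !abs_normZ abs_norm10 !ger0_norm ?subr_ge0// tE.
have := ler_wpM2l l0 Nt0; rewrite mulrDr !mulr1 mulrCA; lra.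
Qed.

Lemma abs_norm_flat (e : R) :
  extreme_point (closed_unit_ball (dual_norm N)) (1, 0) -> 0 < e ->
  exists2 t0, 0 < t0 & forall t, 0 <= t <= t0 -> N (1, t) <= 1 + e * t.
Proof.
move=> [_ ext] e0; apply: contrapT => nflat.
have tangent a b : `|a| + e * `|b| <= N (a, b).
  apply: abs_norm_ge_affine; first exact: ltW.
  move=> t t0; rewrite leNgt; apply/negP => /ltW Nt; apply: nflat.
  by exists t => // s st; exact: abs_norm_le_affine Nt st.
have dual_le1 (s : R) : `|s| = e ->
    closed_unit_ball (dual_norm N) (1, s).
  move=> se; apply: ge_sup; first exact: (dual_norm_has_sup N (1, s)).1.
  move=> _ [[a b] /= Nab <-]; apply: le_trans Nab.
  by rewrite mulr1 normrM se mulrC.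
have e_norm : `|e| = e by rewrite ger0_norm// ltW.
have eN_norm : `|- e| = e by rewrite normrN.
have half01 : 0 < (2^-1 : R) < 1 by lra.
have mid : (1, 0) = 2^-1 *: ((1, e) : R * R) + (1 - 2^-1) *: (1, - e).
  by apply/pair_equal_spec; split;
    rewrite /GRing.scale/= /GRing.scale/=; field.
have [[ee0] _] := ext _ _ _ (dual_le1 _ e_norm) (dual_le1 _ eN_norm) half01 mid.
by move: e0; rewrite ee0 ltxx.
Qed.

(** Homogeneity rescales the flatness of [N] at (1, 0) to every point [(a, 0)];
    as [a >= 1 / 2], the admissible range of [b] does not depend on [a]. *)
Lemma abs_norm_le_flat (e t0 a b : R) :
  (forall t, 0 <= t <= t0 -> N (1, t) <= 1 + e * t) ->
  2^-1 <= a -> 0 <= b -> b <= t0 / 2 -> N (a, b) <= a + e * b.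
Proof.
move=> flat a2 b0 bt0.
have a_gt0 : 0 < a by lra.
set t := b / a; have bE : b = a * t by rewrite mulrC divfK// gt_eqF.
have -> : N (a, b) = a * N (1, t).
  rewrite -[in X in X * _](ger0_norm (ltW a_gt0)) -abs_normZ; congr (N _).
  by apply/pair_equal_spec; rewrite /GRing.scale/= /GRing.scale/= mulr1.
have Nt : N (1, t) <= 1 + e * t.
  apply: flat; rewrite divr_ge0 ?(ltW a_gt0)//= ler_pdivrMr//.
  have t00 : 0 <= t0 by lra.
  by apply: le_trans bt0 _; rewrite ler_wpM2l.
have := ler_wpM2l (ltW a_gt0) Nt; rewrite bE; lra.
Qed.

End abs_norm_smooth.

Section roughness.
Context (R : realType) (X Y : normedModType R) (N : abs_norm R).

Lemma sym_diff_ge0 (x u : X) : `|x| = 1 -> 0 <= `|x + u| + `|x - u| - 2.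
Proof.
move=> x1; have := ler_normD (x + u) (x - u).
have -> : x + u + (x - u) = 2 *: x.
  by rewrite addrCA addrK scaler_nat mulr2n.
by rewrite normrZ x1 mulr1 ger0_norm// subr_ge0.
Qed.

(** The bound covers [u = 0], where the average roughness of the [x i] is [0]
    and the whole roughness of the sum comes from [v]. *)
Lemma average_roughness_abs_sum_le n (x : 'I_n -> X) (e t0 : R) (u : X)
    (v : Y) : (1 <= n)%N -> (forall i, `|x i| = 1) -> 0 <= e ->
  (forall t, 0 <= t <= t0 -> N (1, t) <= 1 + e * t) ->
  `|u| <= 2^-1 -> `|v| <= t0 / 2 ->
  average_roughness (fun i => (x i, 0) : abs_sum N X Y) (u, v) <=
  average_roughness x u + 2 * e.
Proof.
move=> n0 x1 e0 flat u2 vt0; rewrite /average_roughness.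
have nR : n%:R != 0 :> R by rewrite pnatr_eq0 -lt0n.
have -> : 2 * e = n%:R^-1 * \sum_(i < n) (2 * e).
  by rewrite sumr_const card_ord -[(2 * e) *+ n]mulr_natl mulKf.
rewrite -mulrDr ler_wpM2l ?invr_ge0//.
rewrite -big_split; apply: ler_sum => i _ /=.
set p : abs_sum N X Y := (u, v).
have up : `|u| <= `|p|.
  by rewrite abs_sum_normE -[leLHS]normr_id abs_norm_ge_l.
have vp : `|v| <= `|p|.
  by rewrite abs_sum_normE -[leLHS]normr_id abs_norm_ge_r.
have D0 := sym_diff_ge0 _ u (x1 i).
set D := `|x i + u| + `|x i - u| - 2 in D0 *.
have shift (w : X) : `|w| = `|u| ->
    N (`|x i + w|, `|v|) <= `|x i + w| + e * `|v|.
  move=> wu; apply: abs_norm_le_flat flat _ _ vt0 => //.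
  have := lerB_normD (x i) w; rewrite x1 wu; lra.
set q : abs_sum N X Y := (x i, 0).
have num_le : `|q + p| + `|q - p| - 2 <= D + 2 * e * `|p|.
  have -> : `|q + p| = N (`|x i + u|, `|v|).
    by rewrite abs_sum_normE /= add0r.
  have -> : `|q - p| = N (`|x i - u|, `|v|).
    by rewrite abs_sum_normE /= sub0r normrN.
  have := ler_wpM2l e0 vp.
  have := shift u erefl; have := shift (- u) (normrN u); rewrite /D; lra.
have [p0|p0] := eqVneq `|p| 0.
  have u0 : `|u| = 0 by apply/eqP; rewrite eq_le normr_ge0 -p0 up.
  by rewrite p0 u0 !invr0 !mulr0 add0r mulr_ge0.
have p_gt0 : 0 < `|p| by rewrite lt_neqAle eq_sym p0 normr_ge0.
rewrite ler_pdivrMr// mulrDl.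
apply: le_trans num_le _; rewrite lerD2r.
have [u0|u0] := eqVneq u 0.
  by rewrite /D u0 addr0 subr0 x1; have -> : 1 + 1 - 2 = 0 :> R by lra;
    rewrite !mul0r.
have u_gt0 : 0 < `|u| by rewrite normr_gt0.
by rewrite mulrAC ler_pdivlMr// ler_wpM2l.
Qed.

Lemma average_roughness0 n (x : 'I_n -> X) : average_roughness x 0 = 0.
Proof.
by rewrite /average_roughness big1 ?mulr0// => i _; rewrite normr0 invr0 mulr0.
Qed.

End roughness.

Theorem proposition2p11 (R : realType) (X Y : completeNormedModType R)
    (N : abs_norm R) (delta : R) :
  extreme_point (closed_unit_ball (dual_norm N)) (1, 0) ->
  0 < delta ->
  average_rough (abs_sum N X Y) delta ->
  average_rough X delta.
Proof.
move=> ext d0 rough n x n0 x1; apply/le_limf_esup_dnbhs0P => d r dp rp.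
(* One [e] is lost in the limit superior and [2 * e] in the second coordinate;
   [3 * e <= delta] serves to exclude [u = 0]. *)
pose e := Num.min d delta / 3.
have e0 : 0 < e by rewrite divr_gt0// lt_min dp.
have ed : 3 * e <= d by rewrite mulrC divfK// ge_min lexx.
have edelta : 3 * e <= delta by rewrite mulrC divfK// ge_min lexx orbT.
have [t0 t0p flat] := abs_norm_flat _ _ e ext e0.
have xS1 i : `|((x i, 0) : abs_sum N X Y)| = 1.
  by rewrite abs_sum_normE /= normr0 abs_norm_l x1 normr1.
pose r' := Num.min r (Num.min 2^-1 (t0 / 2)).
have r'p : 0 < r' by rewrite !lt_min rp invr_gt0 ltr0Sn divr_gt0.
have /le_limf_esup_dnbhs0P/(_ e r' e0 r'p) := rough n _ n0 xS1.
move=> [[u v] [_ +]]; rewrite !lt_min => /and3P[pr p2 pt] gtp.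
have up : `|u| <= `|(u, v) : abs_sum N X Y|.
  by rewrite abs_sum_normE -[leLHS]normr_id abs_norm_ge_l.
have vp : `|v| <= `|(u, v) : abs_sum N X Y|.
  by rewrite abs_sum_normE -[leLHS]normr_id abs_norm_ge_r.
have gtu : delta - 3 * e < average_roughness x u.
  have := average_roughness_abs_sum_le _ _ _ _ _ x _ _ u v n0 x1 (ltW e0) flat
    (le_trans up (ltW p2)) (le_trans vp (ltW pt)).
  by move: gtp; lra.
exists u; split.
- by apply/eqP => u0; move: gtu; rewrite u0 average_roughness0; lra.
- exact: le_lt_trans pr.
- by apply: le_lt_trans gtu; lra.
Qed.
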